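(* For every positive integer $m$, the Ruzsa number satisfies $R_m \le 192$.
   Context: For a positive integer $m$, let $\mathbb{Z}_m=\mathbb{Z}/m\mathbb{Z}$. For $A\subseteq \mathbb{Z}_m$ and $n\in\mathbb{Z}_m$, let $\sigma_A(n)$ denote the number of ordered pairs $(x,y)\in A\times A$ with $x+y=n$ in $\mathbb{Z}_m$. The Ruzsa number $R_m$ is the least positive integer $r$ such that there exists a set $A\subseteq\mathbb{Z}_m$ with $1\le \sigma_A(n)\le r$ for all $n\in\mathbb{Z}_m$. *)

(* Defs.v *)
From HB Require Import structures.
From mathcomp Require Import all_boot all_order all_algebra.

Set Implicit Arguments.
Unset Strict Implicit.
Unset Printing Implicit Defensive.

Import GRing.Theory.

(* The cyclic group Z/mZ for m > 0.  The library's 'Z_m denotes Z/2Z when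
   m = 1, so we use the additive group of integers modulo m.-1.+1 carried by
   the ordinals, which is Z/mZ for every m > 0, including m = 1.  The value at
   m = 0 (the trivial group) is junk. *)
Definition Zmod (m : nat) : finZmodType := 'I_m.-1.+1.

Definition sigma (m : nat) (A : {set Zmod m}) (n : Zmod m) : nat :=
  #|[set p : Zmod m * Zmod m |
      [&& p.1 \in A, p.2 \in A & (p.1 + p.2 == n)%R]]|.

Definition ruzsa_bound (m r : nat) : bool :=
  (0 < r) && [exists A : {set Zmod m}, forall n : Zmod m, 1 <= sigma A n <= r].

(* Bounds exist: A = Z/mZ itself has finite nonzero representation counts. *)
Lemma ex_ruzsa_bound (m : nat) : exists r, ruzsa_bound m r.
Proof.
have s1 n : 1 <= sigma [set: Zmod m] n.
  by apply/card_gt0P; exists (n, 0%R); rewrite !inE /= addr0 eqxx.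
exists #|{: Zmod m * Zmod m}|; apply/andP; split.
  by apply/card_gt0P; exists (0%R, 0%R).
by apply/existsP; exists setT; apply/forallP => n; rewrite s1 max_card.
Qed.

Definition ruzsa_number (m : nat) : nat := ex_minn (ex_ruzsa_bound m).

(* Main.v *)
Require Import Defs.
From mathcomp Require Import all_boot all_order all_algebra.
From mathcomp Require Import zify ring.

(* By Bertrand's postulate there is a prime p with m / p^2 between about 8 and
   32.  In F_p^2, let k be a nonsquare and consider the parabolas y = c x^2 with
   c = k + 1, k (k + 1), 2 k.  The point (s, z) is the sum of a point of the
   first and one of the second when z - k s^2 is a square, and the sum of two
   points of the third when k (z - k s^2) is a square, so one of these always
   happens; and any two of the parabolas represent (s, z) at most twice.

   To reach Z/mZ, attach to each parabola c a set T_c of nat and take the residues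
   of the integers u + 2 p ((c u^2 mod p) + p t) with u < 2 p and t in T_c.
   Letting u run over two periods absorbs the carry of the first digit, and the
   carry of the second one is absorbed as soon as the third digits t + t' can take
   two consecutive values.  An integer N then has at most
   2 (M (q / p) + M ((q - 1) / p) + M (q' / p)) representations, where
   q = N / (2 p), q' is q or q - 1, and M counts the representations of the third
   digit.  When N runs over a residue class mod m these arguments of M have gaps at
   least H, where H is about m / (2 p^2), and the T_c are chosen so that M sums to
   at most 32 along any such sequence, whence the bound 2 * 3 * 32 = 192. *)

Set Implicit Arguments.
Unset Strict Implicit.
Unset Printing Implicit Defensive.

Import GRing.Theory.

(** * Bertrand's postulate *)

Lemma isqrt_exists (k : nat) : exists r, r ^ 2 <= k < r.+1 ^ 2.
Proof.
elim: k => [|k [r /andP[r_le r_gt]]]; first by exists 0.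
have [lt|ge] := ltnP k.+1 (r.+1 ^ 2); first by exists r; rewrite lt ltnW.
by exists r.+1; rewrite ge /=; nia.
Qed.

Lemma prod_primes_dvdn (s : seq nat) (N : nat) :
    uniq s -> {in s, forall p, prime p -> p %| N} ->
  \prod_(p <- s | prime p) p %| N.
Proof.
elim: s => [|p s IHs] /=; first by rewrite big_nil dvd1n.
case/andP=> p_notin s_uniq dvdN; rewrite big_cons.
have dvds : \prod_(q <- s | prime q) q %| N.
  by apply: IHs => // q qs; apply: dvdN; rewrite inE qs orbT.
case: ifP => // p_pr; rewrite Gauss_dvd ?dvds ?andbT ?dvdN ?mem_head //.
rewrite big_seq_cond; apply: (big_ind (coprime p)) => [|x y|q /andP[qs q_pr]].
- exact: coprimen1.
- by rewrite coprimeMr => -> ->.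
- rewrite prime_coprime // dvdn_prime2 //.
  by apply: contraNneq p_notin => ->.
Qed.

(** The two equal middle coefficients both occur in the expansion of [(1 + 1) ^ m.*2.+1]. *)
Lemma bin_odd_le (m : nat) : 'C(m.*2.+1, m) <= 4 ^ m.
Proof.
have := expnDn 1 1 m.*2.+1; under eq_bigr do rewrite !exp1n !muln1.
have lt1 : m < m.*2.+2 by lia.
have lt2 : m.+1 < m.*2.+2 by lia.
rewrite (bigD1 (Ordinal lt1)) // (bigD1 (Ordinal lt2)) /=; last first.
  by rewrite -val_eqE /= neq_ltn ltnSn orbT.
have -> : 'C(m.*2.+1, m.+1) = 'C(m.*2.+1, m).
  by rewrite -bin_sub; [congr 'C(_, _); lia|lia].
have -> : (1 + 1) ^ m.*2.+1 = 2 * 4 ^ m by rewrite expnS -mul2n expnM.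
by set rest := \sum_(_ < _ | _) _; lia.
Qed.

(** For odd [n = 2 m + 1] the primes from [m + 2] to [n] all divide ['C(n, m)], which is at most
    [4 ^ m], and induction bounds the product of the others by [4 ^ m.+1]. An even [n > 2] adds no
    prime. *)
Lemma primorial_le (n : nat) : \prod_(0 <= p < n.+1 | prime p) p <= 4 ^ n.
Proof.
elim/ltn_ind: n => n IHn.
have [le2|gt2] := leqP n 2.
  by case: n le2 {IHn} => [|[|[|n]]] // _; rewrite unlock.
have [n_odd|n_even] := boolP (odd n); last first.
  have n_npr : prime n = false.
    by apply: contraNF n_even => /even_prime[n2|//]; rewrite n2 in gt2.
  rewrite big_mkcond big_nat_recr //= n_npr muln1 -big_mkcond /=.
  case: n gt2 IHn {n_even n_npr} => // n gt2 IHn.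
  by apply: leq_trans (IHn n _) _; rewrite ?leq_exp2l.
have [m def_n m_gt0] : exists2 m, n = m.*2.+1 & 0 < m.
  by exists n./2; lia.
rewrite (@big_cat_nat _ _ _ m.+2) //=; last by lia.
have le1 : \prod_(0 <= p < m.+2 | prime p) p <= 4 ^ m.+1 by apply: IHn; lia.
have le2 : \prod_(m.+2 <= p < n.+1 | prime p) p <= 4 ^ m.
  apply: leq_trans (bin_odd_le m); apply: dvdn_leq; first by rewrite bin_gt0; lia.
  apply: prod_primes_dvdn; first exact: iota_uniq.
  move=> p; rewrite mem_index_iota => /andP[p_gt p_le] p_pr.
  have : p %| (m.*2.+1)`! by apply: dvdn_fact; lia.
  have m_le : m <= m.*2.+1 by lia.
  rewrite -(bin_fact m_le) !Euclid_dvdM //.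
  have nd k : k < p -> (p %| k`!) = false.
    move=> lt; apply/negbTE; rewrite -prime_coprime // coprime_sym.
    elim: k lt => [|k IHk] lt; first exact: coprime1n.
    rewrite factS coprimeMl IHk ?(ltnW lt) // andbT coprime_sym prime_coprime //.
    by rewrite gtnNdvd.
  by rewrite !nd ?orbF //; lia.
apply: leq_trans (leq_mul le1 le2) _; rewrite def_n -expnD leq_exp2l //; lia.
Qed.

Lemma central_bin_ge (n : nat) : 0 < n -> 4 ^ n <= n.*2 * 'C(n.*2, n).
Proof.
elim: n => // -[|n] IHn _; first by [].
have {IHn} := IHn isT; set k := n.+1 => IHn.
have e1 := mul_bin_diag k.*2.+2 k; have e2 := mul_bin_down k.*2.+1 k.
rewrite /= in e1 e2; rewrite doubleS expnS.
have e3 : k.*2.+1 - k = k.+1 by lia.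
rewrite e3 in e2.
have : 2 * 'C(k.*2.+1, k) = 'C(k.*2.+2, k.+1).
  by apply/eqP; rewrite -(eqn_pmul2l (ltn0Sn k)) -e1; apply/eqP; nia.
move=> e4; rewrite -e4; nia.
Qed.

(** Legendre's formula for [(2 n)! = 'C(2 n, n) * n! ^ 2], with both sums run up to [2 n] so that
    they can be compared termwise. *)
Lemma logn_central_bin (p n : nat) : prime p ->
  \sum_(1 <= k < n.*2.+1) n.*2 %/ p ^ k =
  (\sum_(1 <= k < n.*2.+1) n %/ p ^ k).*2 + logn p 'C(n.*2, n).
Proof.
move=> p_pr; rewrite -logn_fact //.
have n_le : n <= n.*2 by lia.
have subn2 : n.*2 - n = n by lia.
rewrite -(bin_fact n_le) subn2 lognM ?muln_gt0 ?bin_gt0 ?n_le ?fact_gt0 //.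
rewrite lognM ?fact_gt0 // addnn addnC logn_fact //; congr (_.*2 + _).
rewrite [RHS](@big_cat_nat _ _ _ n.+1) //=.
rewrite [X in _ = _ + X]big_nat [X in _ = _ + X]big1 ?addn0 // => k /andP[lt_nk _].
by rewrite divn_small // (leq_trans lt_nk) // ltnW // ltn_expl ?prime_gt1.
Qed.

(** Termwise [n.*2 %/ p ^ k] exceeds twice [n %/ p ^ k] by at most 1, and by 0 once [p ^ k > 2 n];
    so the exponent is at most the logarithm of [2 n] to base [p]. *)
Lemma central_bin_ppart_le (p n : nat) : prime p -> 0 < n ->
  p ^ logn p 'C(n.*2, n) <= n.*2.
Proof.
move=> p_pr n_gt0; have p_gt1 := prime_gt1 p_pr.
set L := trunc_log p n.*2.
suff le_L : logn p 'C(n.*2, n) <= L.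
  by apply: leq_trans (trunc_logP p_gt1 _); rewrite ?leq_exp2l ?double_gt0.
rewrite -(leq_add2l (\sum_(1 <= k < n.*2.+1) n %/ p ^ k).*2) -logn_central_bin //.
have cnt N : \sum_(1 <= k < N.+1) (k <= L) <= minn N L.
  elim: N => [|N IHN]; first by rewrite big_geq.
  by rewrite big_nat_recr //=; move: IHN; case: (leqP N.+1 L) => /=; lia.
apply: leq_trans (_ : _ <= (\sum_(1 <= k < n.*2.+1) n %/ p ^ k).*2 +
   \sum_(1 <= k < n.*2.+1) (k <= L)) _; last first.
  by rewrite leq_add2l (leq_trans (cnt _)) // geq_minr.
rewrite -(muln2 (\sum_(_ <= k < _) _)) big_distrl -big_split /=; apply: leq_sum => k _.
have pk_gt0 : 0 < p ^ k by rewrite expn_gt0 ltnW.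
have [k_le|k_gt] := leqP k L.
  by rewrite -ltnS ltn_divLR //; have := ltn_ceil n pk_gt0; nia.
rewrite divn_small // (leq_trans (trunc_log_ltn _ p_gt1)) //.
by rewrite leq_exp2l.
Qed.

Lemma central_bin_logn_eq0 (p n : nat) : prime p -> 2 < p ->
  n.*2 < 3 * p -> p <= n -> logn p 'C(n.*2, n) = 0.
Proof.
move=> p_pr p_gt2 p_gt p_le.
suff eq_sum : \sum_(1 <= k < n.*2.+1) n.*2 %/ p ^ k =
  (\sum_(1 <= k < n.*2.+1) n %/ p ^ k).*2.
  by have := logn_central_bin n p_pr; rewrite eq_sum; lia.
rewrite -(muln2 (\sum_(_ <= k < _) _)) big_distrl /= !big_nat.
apply: eq_bigr => k /andP[k_gt0 _].
case: k k_gt0 => // -[|k] _.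
  have e1 : n %/ p = 1 by apply/eqP; rewrite eqn_leq -ltnS ltn_divLR ?leq_divRL; lia.
  have e2 : n.*2 %/ p = 2 by apply/eqP; rewrite eqn_leq -ltnS ltn_divLR ?leq_divRL; lia.
  by rewrite expn1 e1 e2.
have lt : n.*2 < p ^ k.+2.
  apply: leq_trans (_ : p ^ 2 <= _); first by rewrite expnS expn1; nia.
  by rewrite leq_exp2l // prime_gt1.
by rewrite !divn_small //; lia.
Qed.

(** Primes up to [r] contribute at most [2 n] each, primes from there to [2 n / 3] divide at most
    once and are bounded by the primorial, and larger primes do not divide at all. *)
Lemma central_bin_le (n r : nat) : 29 < r -> r ^ 2 <= n.*2 < r.+1 ^ 2 ->
  (forall p, n < p < n.*2 -> ~~ prime p) ->
  'C(n.*2, n) <= n.*2 ^ r.-1 * 4 ^ (n.*2 %/ 3).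
Proof.
move=> r_gt /andP[r_le r_lt] no_prime.
set q := n.*2 %/ 3; set C := 'C(n.*2, n).
have C_gt0 : 0 < C by rewrite bin_gt0; lia.
have n_gt : 0 < n by nia.
have q_lt : n.*2 < 3 * q.+1 by rewrite mulnC ltn_ceil.
have q_le : q * 3 <= n.*2 by apply: leq_divM.
have tail p : q < p -> p ^ logn p C = 1.
  move=> q_ltp; have [p_pr|p_npr] := boolP (prime p); last first.
    by rewrite lognE (negbTE p_npr).
  have [p_le|p_gt] := leqP p n.
    by rewrite central_bin_logn_eq0 //; nia.
  have [p_lt|p_ge] := ltnP p n.*2.
    by have := no_prime p; rewrite p_gt p_lt p_pr => /(_ isT).
  have [p_eq|p_neq] := eqVneq p n.*2.
    by have := even_prime p_pr; rewrite p_eq odd_double; lia.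
  suff : p ^ logn p C < p ^ 1.
    by rewrite ltn_exp2l ?prime_gt1 // ltnS leqn0 => /eqP->.
  by rewrite expn1 (leq_ltn_trans (central_bin_ppart_le p_pr n_gt)) //; lia.
rewrite -[leqLHS](partnT C_gt0) (@widen_partn (maxn C q)) ?leq_maxl //.
rewrite (@big_cat_nat _ _ _ q.+1) //=; last by rewrite ltnS leq_maxr.
rewrite [X in _ * X]big_nat_cond [X in _ * X]big1 ?muln1; last first.
  by move=> p /andP[/andP[]] + _ _; apply: tail.
rewrite (@big_cat_nat _ _ _ r.+1) //=; last by nia.
apply: leq_mul.
  rewrite big_ltn // big_ltn; last by lia.
  rewrite (_ : 0 ^ logn 0 C = 1) // (_ : 1 ^ logn 1 C = 1) // !mul1n.
  apply: leq_trans (_ : \prod_(2 <= p < r.+1) n.*2 <= _); last first.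
    by rewrite prod_nat_const_nat subSS subn1.
  apply: leq_prod => p _; have [p_pr|p_npr] := boolP (prime p).
    exact: central_bin_ppart_le.
  by rewrite lognE (negbTE p_npr) double_gt0.
apply: leq_trans (primorial_le q).
rewrite [leqRHS](@big_cat_nat _ _ _ r.+1) //=; last by nia.
rewrite -[leqLHS]mul1n leq_mul //.
  by apply: prodn_cond_gt0 => p /prime_gt0.
rewrite big_nat_cond [leqRHS]big_mkcond [leqRHS]big_nat_cond /=.
apply: leq_prod => p; rewrite andbT => /andP[r_ltp _].
case: ifP => [p_pr|p_npr]; last by rewrite lognE p_npr.
rewrite -[leqRHS]expn1 leq_exp2l ?prime_gt1 // -ltnS.
rewrite -(ltn_exp2l _ _ (prime_gt1 p_pr)).
apply: leq_ltn_trans (central_bin_ppart_le p_pr n_gt) _.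
by apply: leq_trans r_lt _; rewrite leq_exp2r.
Qed.

(** The base case is [31 ^ 6 < 32 ^ 6 = 2 ^ 30]; afterwards the left side grows by at most
    [(9 / 8) ^ 3 < 2] per step. *)
Lemma expn6_lt (r : nat) : 29 < r -> r.+1 ^ 6 < 2 ^ r.
Proof.
elim: r => // r IHr; rewrite ltnS leq_eqVlt => /predU1P[r_eq|r_gt].
  have -> : r.+1 = 5 * 6 by lia.
  by rewrite expnM ltn_exp2r.
have {IHr} := IHr r_gt; have -> : 6 = 2 * 3 by [].
have : r.+2 ^ 2 * 8 <= r.+1 ^ 2 * 9 by nia.
rewrite !expnM [2 ^ r.+1]expnS.
set a := r.+2 ^ 2; set b := r.+1 ^ 2; move=> le_ab lt_b.
have : (a * 8) ^ 3 <= (b * 9) ^ 3 by rewrite leq_exp2r.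
rewrite !expnMn; lia.
Qed.

Lemma bertrand (n : nat) : 1 < n -> exists2 p, prime p & n < p < n.*2.
Proof.
move=> n_gt1; have [n_lt|n_ge] := ltnP n 631.
  (* Small [n] are handled by a chain of primes, each less than twice its predecessor. *)
  have step p q : prime q -> q < p.*2 -> p <= n < q ->
      exists2 p, prime p & n < p < n.*2.
    by move=> q_pr q_lt /andP[p_le n_lt']; exists q => //; lia.
  have [?|?] := ltnP n 3; first by apply: (@step 2 3) => //; lia.
  have [?|?] := ltnP n 5; first by apply: (@step 3 5) => //; lia.
  have [?|?] := ltnP n 7; first by apply: (@step 5 7) => //; lia.
  have [?|?] := ltnP n 13; first by apply: (@step 7 13) => //; lia.
  have [?|?] := ltnP n 23; first by apply: (@step 13 23) => //; lia.
  have [?|?] := ltnP n 43; first by apply: (@step 23 43) => //; lia.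
  have [?|?] := ltnP n 83; first by apply: (@step 43 83) => //; lia.
  have [?|?] := ltnP n 163; first by apply: (@step 83 163) => //; lia.
  have [?|?] := ltnP n 317; first by apply: (@step 163 317) => //; lia.
  by apply: (@step 317 631) => //; lia.
have [/hasP[p + p_pr]|/hasPn none] := boolP (has prime (index_iota n.+1 n.*2)).
  by rewrite mem_index_iota; exists p.
have [r r_bnd] := isqrt_exists n.*2.
have r_gt : 29 < r by rewrite ltnNge; apply/negP => r_le; nia.
have no_prime p : n < p < n.*2 -> ~~ prime p by rewrite -mem_index_iota; apply: none.
have bin_le := central_bin_le r_gt r_bnd no_prime.
have n_gt0 : 0 < n by lia.
have := leq_trans (central_bin_ge n_gt0) (leq_mul (leqnn n.*2) bin_le).
have q_le : n.*2 %/ 3 * 3 <= n.*2 by apply: leq_divM.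
set q := n.*2 %/ 3 in q_le *; rewrite mulnA -expnS prednK; last by lia.
rewrite -{1}(@subnK q n) ?expnD ?leq_pmul2r ?expn_gt0 //; last by lia.
rewrite leqNgt => /negP[].
(* After cubing, [3 q <= 2 n] and [r ^ 2 <= 2 n < (r + 1) ^ 2] reduce the claim to
   [(r + 1) ^ (6 r) < 2 ^ (r ^ 2)]. *)
rewrite -(@ltn_exp2r _ _ 3) // -!expnM.
apply: leq_trans (_ : 4 ^ n <= _); last by rewrite leq_exp2l //; lia.
apply: leq_trans (_ : 2 ^ (r * r) <= _); last first.
  by rewrite -[4]/(2 ^ 2) -expnM leq_exp2l //; nia.
apply: leq_ltn_trans (_ : (r.+1 ^ 2) ^ (r * 3) < _).
  by rewrite leq_exp2r; lia.
have -> : (r.+1 ^ 2) ^ (r * 3) = (r.+1 ^ 6) ^ r by rewrite -!expnM; congr (_ ^ _); lia.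
by rewrite expnM ltn_exp2r ?expn6_lt //; lia.
Qed.

(** * Sums of parabolas over a finite field *)

Section FiniteField.
Local Open Scope ring_scope.
Variable F : finFieldType.
Hypothesis two_neq0 : 2 != 0 :> F.

Definition nzsqr : {set F} := [set x ^+ 2 | x in [set~ (0 : F)]].

Lemma card_nzsqr : (#|nzsqr| * 2 = #|F|.-1)%N.
Proof.
rewrite -(cardsC1 (0 : F)) -[RHS]sum1_card.
rewrite (partition_big_imset (fun x : F => x ^+ 2)) /= -/nzsqr.
rewrite -sum_nat_const; apply: eq_bigr => _ /imsetP[a a_neq0 ->].
rewrite !inE in a_neq0; rewrite sum1dep_card; transitivity #|[set a; - a]|.
  rewrite cards2 (_ : a != - a) //; apply: contraNneq two_neq0 => aNa.
  by rewrite -(inj_eq (mulfI a_neq0)) mulr0 mulr_natr mulr2n {2}aNa subrr.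
congr #|pred_of_set _|; apply/setP => x; rewrite !inE eqf_sqr.
apply/idP/andP => [x_eq|[]//]; split=> //.
by case/orP: x_eq => /eqP->; rewrite ?oppr_eq0.
Qed.

Definition nonsquare (k : F) := forall x, x ^+ 2 != k.

Lemma nonsquareP k : k != 0 -> k \notin nzsqr -> nonsquare k.
Proof.
move=> k_neq0 /imsetP k_notin x; apply/eqP => x_eq; case: k_notin.
exists x => //; rewrite !inE; apply: contraNneq k_neq0 => x0.
by rewrite -x_eq x0 expr0n.
Qed.

(** The nonzero squares and their multiples by [k] are disjoint, and each set is half of the nonzero
    elements, so together they exhaust them. *)
Lemma nonsquare_dichotomy k D : nonsquare k ->
  (exists e, D = e ^+ 2) \/ (exists e, k * D = e ^+ 2).
Proof.
move=> k_nonsq.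
have k_neq0 : k != 0 by have := k_nonsq 0; rewrite expr0n eq_sym.
have [->|D_neq0] := eqVneq D 0; first by left; exists 0; rewrite expr0n.
have [/imsetP[e _ ->]|D_notin] := boolP (D \in nzsqr); first by left; exists e.
pose T := [set k * y | y in nzsqr].
have cardT : #|T| = #|nzsqr| by rewrite card_imset //; apply: mulfI.
have disj : [disjoint nzsqr & T].
  rewrite -setI_eq0; apply/eqP/setP => x; rewrite !inE; apply/negP.
  case/andP=> /imsetP[a a0 ->] /imsetP[_ /imsetP[b b0 ->]] ab.
  rewrite !inE in b0.
  have := k_nonsq (a / b); rewrite expr_div_n ab mulfK ?eqxx //.
  by rewrite expf_neq0.
have cov : nzsqr :|: T = [set~ 0%R].
  apply/eqP; rewrite eqEcard; apply/andP; split.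
    apply/subsetP => x; rewrite !inE => /orP[|] /imsetP[a].
      by rewrite !inE => a0 ->; rewrite expf_neq0.
    by case/imsetP=> b; rewrite !inE => b0 -> ->; rewrite mulf_neq0 ?expf_neq0.
  by rewrite cardsU (disjoint_setI0 disj) cards0 subn0 cardT cardsC1 addnn
    -muln2 card_nzsqr.
have : D \in nzsqr :|: T by rewrite cov !inE.
rewrite inE (negbTE D_notin) => /imsetP[_ /imsetP[b _ ->] ->].
by right; exists (k * b); ring.
Qed.

Lemma exists_nonsquare (s : seq F) : (2 * size s < #|F|.-1)%N ->
  exists2 k, nonsquare k & k \notin s.
Proof.
move=> s_lt.
have [/subsetP sub|/subsetPn[k]] := boolP ([set~ 0%R] \subset nzsqr :|: [set x in s]).
  have le : (#|F|.-1 <= #|nzsqr| + #|[set x in s]|)%N.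
    rewrite -(cardsC1 (0 : F)) (leq_trans (subset_leq_card (introT subsetP sub))) //.
    exact: leq_card_setU.
  have : (#|[set x in s]| <= size s)%N by rewrite cardsE card_size.
  by move: le s_lt; rewrite -card_nzsqr; lia.
rewrite !inE negb_or => k0 /andP[k_notin k_s]; exists k => //.
exact: nonsquareP.
Qed.

(* The parabolas k + 1, k (k + 1) on the one hand and 2 k, 2 k on the other have
   the same value k of c d / (c + d), so both discriminants are multiples of
   z - k s^2, with quotients that differ by a nonsquare. *)
Lemma parabola_sum_cover (k s z : F) : nonsquare k -> k != -1 ->
  (exists x, (k + 1) * x ^+ 2 + k * (k + 1) * (s - x) ^+ 2 = z) \/
  (exists x, 2 * k * x ^+ 2 + 2 * k * (s - x) ^+ 2 = z).
Proof.
move=> k_nonsq k_neqN1.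
have k_neq0 : k != 0 by have := k_nonsq 0; rewrite expr0n eq_sym.
have k1_neq0 : k + 1 != 0 by rewrite addr_eq0.
have [[e De]|[e De]] := nonsquare_dichotomy (z - k * s ^+ 2) k_nonsq.
  (* Completing the square gives [((k + 1) x - k s) ^ 2 = z - k s ^ 2] here, and
     [k (2 x - s) ^ 2 = z - k s ^ 2] in the other case. *)
  left; exists ((k * s + e) / (k + 1)).
  have -> : z = k * s ^+ 2 + e ^+ 2 by rewrite -De; ring.
  by field.
right; exists ((s + e / k) / 2).
have -> : z = k * s ^+ 2 + e ^+ 2 / k by rewrite -De; field.
by field; rewrite k_neq0.
Qed.

Lemma parabola_sum_card (c d s z : F) : c + d != 0 ->
  (#|[set x | (c * x ^+ 2 + d * (s - x) ^+ 2 == z)%R]| <= 2)%N.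
Proof.
move=> cd_neq0; set S := [set x | _].
have [->|[a]] := set_0Vmem S; first by rewrite cards0.
(* [b] is the second root, read off from the sum of the roots. *)
rewrite inE => /eqP a_eq; pose b := 2 * d * s / (c + d) - a.
suff sub : S \subset [set a; b].
  by rewrite (leq_trans (subset_leq_card sub)) // cards2; case: eqP.
apply/subsetP => x; rewrite !inE => /eqP x_eq.
have : (c + d) * (x - a) * (x - b) = 0.
  have := subrr z; rewrite -{1}x_eq -a_eq => <-.
  by rewrite /b; field.
by move/eqP; rewrite !mulf_eq0 (negbTE cd_neq0) !subr_eq0.
Qed.

Lemma exists_parabolas : (7 < #|F|)%N -> exists a b c : F,
  {in [:: a; b; c] &, forall x y, x + y != 0} /\
  forall s z, (exists x, a * x ^+ 2 + b * (s - x) ^+ 2 = z) \/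
              (exists x, c * x ^+ 2 + c * (s - x) ^+ 2 = z).
Proof.
move=> card_gt.
(* The pairwise sums of coefficients factor into 2, [k], [k + 1], [k + 3] and [3 k + 1]; the list
   holds the zeros of the last three. In characteristic 3, [3 k + 1] is 1. *)
have size_lt : (2 * size [:: -1 : F; -3; - 3^-1]%R < #|F|.-1)%N by rewrite ltn_predRL.
have [k k_nonsq] := exists_nonsquare size_lt.
rewrite !inE !negb_or => /and3P[kN1 kN3 kN13].
have k_neq0 : k != 0 by have := k_nonsq 0; rewrite expr0n eq_sym.
exists (k + 1), (k * (k + 1)), (2 * k); split; last first.
  by move=> s z; apply: parabola_sum_cover.
have k1 : k + 1 != 0 by rewrite addr_eq0.
have k3 : k + 3 != 0 by rewrite addr_eq0.
have k31 : 3 * k + 1 != 0.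
  have [e3|n3] := eqVneq (3 : F) 0; first by rewrite e3 mul0r add0r oner_eq0.
  apply: contraNneq kN13 => e; apply/eqP.
  by rewrite -[k](mulKf n3) -[3 * k](addrK 1) e; field.
have n1 : 2 * (k + 1) != 0 by rewrite mulf_neq0.
have n2 : (k + 1) ^+ 2 != 0 by rewrite expf_neq0.
have n3 : 2 * (k * (k + 1)) != 0 by rewrite !mulf_neq0.
have n4 : k * (k + 3) != 0 by rewrite mulf_neq0.
have n5 : 2 * (2 * k) != 0 by rewrite !mulf_neq0.
move=> x y; rewrite !inE => /or3P[] /eqP-> /or3P[] /eqP->.
- by rewrite (_ : _ + _ = 2 * (k + 1)) //; ring.
- by rewrite (_ : _ + _ = (k + 1) ^+ 2) //; ring.
- by rewrite (_ : _ + _ = 3 * k + 1) //; ring.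
- by rewrite (_ : _ + _ = (k + 1) ^+ 2) //; ring.
- by rewrite (_ : _ + _ = 2 * (k * (k + 1))) //; ring.
- by rewrite (_ : _ + _ = k * (k + 3)) //; ring.
- by rewrite (_ : _ + _ = 3 * k + 1) //; ring.
- by rewrite (_ : _ + _ = k * (k + 3)) //; ring.
- by rewrite (_ : _ + _ = 2 * (2 * k)) //; ring.
Qed.
End FiniteField.

(** * Representation counts of sets of residues *)

Section Residues.
Variables (m : nat) (m_gt0 : 0 < m).

Definition residues (E : seq nat) : {set Zmod m} :=
  [set x : Zmod m | has (fun a => a %% m == x) E].

Lemma val_addZmod (x y : Zmod m) : (x + y)%R = (x + y) %% m :> nat.
Proof. by congr (_ %% _); apply: prednK. Qed.

Lemma ltn_Zmod (x : Zmod m) : x < m.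
Proof. by move: (ltn_ord x); rewrite [X in _ < X](prednK m_gt0). Qed.

Lemma sigma_residues_gt0 (E : seq nat) (n : Zmod m) :
  (exists a b, [/\ a \in E, b \in E & a + b = n %[mod m]]) ->
  0 < sigma (residues E) n.
Proof.
case=> a [b [aE bE ab]]; apply/card_gt0P.
have lt c : c %% m < m.-1.+1 by rewrite prednK // ltn_mod.
exists (Ordinal (lt a) : Zmod m, Ordinal (lt b) : Zmod m).
rewrite !inE /=; apply/and3P; split; first by apply/hasP; exists a => /=.
  by apply/hasP; exists b => /=.
apply/eqP/val_inj; rewrite [LHS]val_addZmod /= modnDm ab modn_small //; apply: ltn_Zmod.
Qed.

Lemma sigma_le_card (A : {set Zmod m}) (n : Zmod m) : sigma A n <= #|A|.
Proof.
rewrite /sigma -(@card_in_imset _ _ fst) => [|[x y] [x' y']]; last first.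
  rewrite !inE /= => /and3P[_ _ /eqP <-] /and3P[_ _ /eqP e] xx'.
  by congr (_, _) => //; move: e; rewrite xx' => /addrI.
by apply/subset_leq_card/subsetP => _ /imsetP[[x y] + ->]; rewrite inE /= => /and3P[].
Qed.

Lemma card_residues_le (E : seq nat) : #|residues E| <= size E.
Proof.
have lt c : c %% m < m.-1.+1 by rewrite prednK // ltn_mod.
pose s : seq (Zmod m) := [seq Ordinal (lt a) | a <- E].
rewrite -(size_map (fun a => Ordinal (lt a) : Zmod m) E) -/s.
apply: leq_trans (card_size s); apply/subset_leq_card/subsetP => x.
rewrite inE => /hasP[a aE /eqP ax]; apply/mapP; exists a => //.
exact: val_inj.
Qed.

(** Each pair of residues lifts to a pair in [E] whose sum is one of [n], [n + m], [n + 2 m], and so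
    on; finitely many of these suffice because [E] is finite. *)
Lemma sigma_residues_le (E : seq nat) (n : Zmod m) :
  exists K, sigma (residues E) n <=
    \sum_(0 <= k < K) \sum_(a <- E) \sum_(b <- E) (a + b == n + k * m).
Proof.
exists (sumn E + sumn E).+1.
have lt c : c %% m < m.-1.+1 by rewrite prednK // ltn_mod.
pose toZ a : Zmod m := Ordinal (lt a).
have le_sumn a : a \in E -> a <= sumn E.
  elim: E => //= e E IHE; rewrite inE => /predU1P[->|/IHE]; lia.
pose s := [seq ab <- [seq (a, b) | a <- E, b <- E] | ab.1 + ab.2 == n %[mod m]].
apply: leq_trans (_ : size s <= _).
  rewrite -(size_map (fun ab => (toZ ab.1, toZ ab.2)) s).
  apply: leq_trans (card_size _); apply/subset_leq_card/subsetP => -[x y].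
  rewrite !inE /= => /and3P[/hasP[a aE /eqP ax] /hasP[b bE /eqP bY] /eqP xy].
  apply/mapP; exists (a, b); last by congr (_, _); apply: val_inj.
  rewrite mem_filter allpairs_f // andbT /= -modnDm ax bY -val_addZmod xy.
  by rewrite modn_small // ltn_Zmod.
rewrite size_filter -sum1_count big_mkcond big_allpairs /=.
rewrite [leqRHS]exchange_big /= big_seq [leqRHS]big_seq; apply: leq_sum => a aE.
rewrite [leqRHS]exchange_big /= big_seq [leqRHS]big_seq; apply: leq_sum => b bE.
case: ifP => // /eqP ab.
rewrite (bigD1_seq ((a + b) %/ m)) ?iota_uniq //=.
  suff -> : a + b == n + (a + b) %/ m * m by [].
  by rewrite {1}(divn_eq (a + b) m) ab (modn_small (ltn_Zmod _)) // addnC.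
rewrite mem_index_iota /= ltnS (leq_trans (leq_div _ _)) //.
by rewrite leq_add ?le_sumn.
Qed.

End Residues.

(** Two-digit expansions in base 64 reach every residue, and 128 is the number of listed elements,
    which bounds every count. *)
Lemma ruzsa_bound_small (m : nat) : 0 < m -> m <= 4096 -> ruzsa_bound m 128.
Proof.
move=> m_gt0 m_le; apply/andP; split=> //; apply/existsP.
pose E := iota 0 64 ++ [seq i * 64 | i <- iota 0 64].
exists (residues m E); apply/forallP => n; apply/andP; split; last first.
  by rewrite (leq_trans (sigma_le_card _ _)) // (leq_trans (card_residues_le _ _)).
apply: sigma_residues_gt0 => //; exists (n %% 64), (n %/ 64 * 64).
have n_lt : n < 64 * 64 by apply: leq_trans (ltn_Zmod m_gt0 n) m_le.
split; rewrite ?mem_cat ?mem_iota ?ltn_mod //.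
  apply/orP; right; apply/mapP; exists (n %/ 64) => //.
  by rewrite mem_iota /= add0n ltn_divLR.
by rewrite addnC -divn_eq.
Qed.

(** * Sums of entries at well separated indices *)

Section GapSum.
Variable H : nat.

(** Dynamic programming from the right: entry [i] is the optimum for [drop i s]. Either the head is
    skipped, or it is taken and the next [H - 1] entries are passed over; beyond the end the default
    0 is the right value. *)
Fixpoint gap_maxima (s : seq nat) : seq nat :=
  if s is a :: s' then
    let g := gap_maxima s' in maxn (head 0 g) (a + nth 0 g H.-1) :: g
  else [::].

(* The largest sum of entries of s at indices that are pairwise at least H apart. *)
Definition gap_max (s : seq nat) : nat := head 0 (gap_maxima s).

Lemma drop_gap_maxima (i : nat) (s : seq nat) :
  drop i (gap_maxima s) = gap_maxima (drop i s).
Proof. by elim: i s => [|i IHi] [|a s] //=; rewrite ?drop0. Qed.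

(** The induction follows the two branches of [gap_maxima], according to whether [v 0] is 0. Indices
    past the end of [s] contribute 0, so [v] may be an infinite sequence. *)
Lemma gap_sum_le (s : seq nat) (v : nat -> nat) (K : nat) : 0 < H ->
  (forall k, v k + H <= v k.+1) -> \sum_(0 <= k < K) nth 0 s (v k) <= gap_max s.
Proof.
move=> H_gt0; move: {2}(size s).+1 (ltnSn (size s)) => l.
elim: l s v K => // l IHl [|a s] v K; first by rewrite big1 // => *; rewrite nth_nil.
rewrite ltnS /= => s_lt v_gap; rewrite /gap_max /=.
have v_ge k : 0 < k -> H <= v k by case: k => // k _; have := v_gap k; lia.
have [v0|v0] := posnP (v 0); last first.
  rewrite leq_max; apply/orP; left.
  have v_gt0 k : 0 < v k by case: k => // k; apply: leq_trans (v_ge k.+1 _).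
  under eq_bigr => k _ do rewrite -(prednK (v_gt0 k)).
  by apply: IHl => // k; have := v_gap k; have := v_gt0 k; have := v_gt0 k.+1; lia.
case: K => [|K]; first by rewrite big_geq.
rewrite leq_max; apply/orP; right.
rewrite big_nat_recl // v0 /= leq_add2l.
rewrite -[H.-1]addn0 -nth_drop drop_gap_maxima nth0.
have -> : \sum_(0 <= k < K) nth 0 (a :: s) (v k.+1) =
    \sum_(0 <= k < K) nth 0 (drop H.-1 s) (v k.+1 - H).
  apply: eq_bigr => k _; rewrite nth_drop.
  have -> : v k.+1 = (H.-1 + (v k.+1 - H)).+1 by have := v_ge k.+1; lia.
  by rewrite /=; congr nth; lia.
apply: (IHl _ (fun k => v k.+1 - H)) => [|k]; first by rewrite size_drop; lia.
by have := v_gap k.+1; have := v_ge k.+1; lia.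
Qed.
End GapSum.

(** * Lifting the parabolas to the integers *)

(* The second count is for the case of a carry from the previous digit. *)
Definition load (T T' : seq nat) (v : nat) : nat :=
  maxn (count_mem v [seq t + t' | t <- T, t' <- T'])
       (count_mem v [seq (t + t').+1 | t <- T, t' <- T']).

Lemma count_sums (j v : nat) (T T' : seq nat) : j <= 1 ->
  \sum_(t <- T) \sum_(t' <- T') (t + t' + j == v) <= load T T' v.
Proof.
have count_sum s : count_mem v s = \sum_(x <- s) (x == v).
  by rewrite -sum1_count big_mkcond.
move=> j_le; rewrite /load leq_max !count_sum !big_allpairs_dep.
apply/orP; case: j j_le => [|[|//]] _; [left|right].
  by under eq_bigr do under eq_bigr do rewrite addn0.
by under eq_bigr do under eq_bigr do rewrite addn1.
Qed.

Section Parabolas.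
Variables (p : nat) (p_pr : prime p).
Let p_gt0 : 0 < p := prime_gt0 p_pr.

Definition parab (c : 'F_p) (u : nat) : nat := (c * u%:R ^+ 2)%R.

Lemma parab_lt c u : parab c u < p.
Proof. by move: (ltn_ord (c * u%:R ^+ 2)%R); rewrite [X in _ < X](Fp_cast p_pr). Qed.

Lemma natr_val_Fp (x : 'F_p) : (x : nat)%:R%R = x.
Proof. exact: natr_Zp. Qed.

Lemma eqn_mod_Fp (a b : nat) : (a == b %[mod p]) = (a%:R == b%:R :> 'F_p)%R.
Proof. by rewrite -val_eqE /= !val_Fp_nat. Qed.

Lemma parab_periodic c u i : parab c (u + p * i) = parab c u.
Proof. by rewrite /parab natrD natrM pchar_Fp_0 // mul0r addr0. Qed.

(** Bounds the number of [u < 2 p] in a given class mod [p] for which [s - u] also lies in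
    [[0, 2 p)]. *)
Definition multiplicity (s : nat) : nat := if p <= s < 3 * p then 2 else 1.

(** Since [u'] is [s - u], the class of [u] is one of at most two roots of a quadratic equation, and
    each root has at most [multiplicity s] lifts. *)
Lemma count_pairs (c d : 'F_p) (s z : nat) : (c + d != 0)%R ->
  \sum_(0 <= u < 2 * p) \sum_(0 <= u' < 2 * p)
     (u + u' == s) && (parab c u + parab d u' == z %[mod p])
  <= 2 * multiplicity s.
Proof.
move=> cd_neq0.
pose G (x : 'F_p) := (c * x ^+ 2 + d * (s%:R - x) ^+ 2 == z%:R)%R.
have inner u : \sum_(0 <= u' < 2 * p)
     (u + u' == s) && (parab c u + parab d u' == z %[mod p])
    <= (u <= s < u + 2 * p) && G u%:R%R.
  have [/andP[u_le s_lt]|u_out] := boolP (u <= s < u + 2 * p); last first.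
    rewrite big_nat big1 // => u' /andP[_ u'_lt].
    by case: eqP => //= us; case/negP: u_out; lia.
  rewrite (bigD1_seq (s - u)) ?iota_uniq ?mem_index_iota //=; last by lia.
  rewrite big1 ?addn0 => [|u' u'_neq]; last by case: eqP => //=; lia.
  by rewrite subnKC // eqxx /= eqn_mod_Fp natrD !natr_val_Fp natrB.
apply: leq_trans (leq_sum _ (fun u _ => inner u)) _.
rewrite (@big_cat_nat _ _ _ p) //=; last by lia.
have shift f : \sum_(p <= u < 2 * p) f u = \sum_(0 <= u < p) f (u + p).
  by rewrite -{1}[p]add0n big_addn mul2n -addnn addnK.
rewrite shift -big_split /=.
apply: leq_trans (_ : \sum_(0 <= x < p) multiplicity s * G x%:R%R <= _).
  rewrite !big_nat; apply: leq_sum => x /andP[_ x_lt].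
  rewrite natrD pchar_Fp_0 // addr0 /multiplicity; case: (G _); rewrite ?andbF ?andbT //=.
  case: ifP => [_|s_out]; first by do 2!case: (_ <= _ < _).
  by case: (boolP (x <= _ < _)) => //= ?; case: (boolP (x + p <= _ < _)) => //= ?; lia.
rewrite -big_distrr /= mulnC leq_mul2r; apply/orP; right.
rewrite -[X in index_iota 0 X](Fp_cast p_pr) big_mkord.
under eq_bigr do rewrite natr_val_Fp.
rewrite -[X in X <= _]big_mkcond sum1dep_card.
exact: parabola_sum_card.
Qed.

Definition code (c : 'F_p) (u t : nat) : nat := u + 2 * p * (parab c u + p * t).

(** The two terms belong to the carries [h = 0] and [h = 1] out of the first digit. Given [h], the
    number [N] fixes [u + u'] and the residue of the second digits; their carry [j] is absorbed by
    [load]. *)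
Lemma count_codes (c d : 'F_p) (T T' : seq nat) (N : nat) : (c + d != 0)%R ->
  \sum_(0 <= u < 2 * p) \sum_(0 <= u' < 2 * p) \sum_(t <- T) \sum_(t' <- T')
     (code c u t + code d u' t' == N)
  <= 2 * (multiplicity (N %% (2 * p)) * load T T' (N %/ (2 * p) %/ p) +
          multiplicity (N %% (2 * p) + 2 * p) * load T T' ((N %/ (2 * p) - 1) %/ p)).
Proof.
move=> cd_neq0.
pose s h := N %% (2 * p) + 2 * p * h; pose z h := N %/ (2 * p) - h.
have [-> ->] : N %% (2 * p) = s 0 /\ s 0 + 2 * p = s 1 by rewrite /s; lia.
rewrite -[N %/ (2 * p)]subn0 -/(z 0) {2}/z subn0 -/(z 1).
pose K h u u' : nat := (u + u' == s h) && (parab c u + parab d u' == z h %[mod p]).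
have bound u u' : u < 2 * p -> u' < 2 * p ->
    \sum_(t <- T) \sum_(t' <- T') (code c u t + code d u' t' == N) <=
    K 0 u u' * load T T' (z 0 %/ p) + K 1 u u' * load T T' (z 1 %/ p).
  move=> u_lt u'_lt; pose h := (u + u') %/ (2 * p).
  pose w := parab c u + parab d u'; pose j := w %/ p.
  have h_le : h <= 1 by rewrite /h -ltnS ltn_divLR; lia.
  have w_lt : w < 2 * p.
    by rewrite /w; have := parab_lt c u; have := parab_lt d u'; lia.
  have j_le : j <= 1 by rewrite /j -ltnS ltn_divLR.
  suff le_h : \sum_(t <- T) \sum_(t' <- T') (code c u t + code d u' t' == N) <=
      K h u u' * load T T' (z h %/ p).
    apply: leq_trans le_h _.
    by case: (h) h_le => [|[|//]] _; rewrite ?leq_addr ?leq_addl.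
  apply: leq_trans (leq_mul (leqnn _) (count_sums (z h %/ p) T T' j_le)).
  rewrite big_distrr; apply: leq_sum => t _.
  rewrite big_distrr; apply: leq_sum => t' _; case: eqP => //= e.
  have e' : N = (w + p * (t + t') + h) * (2 * p) + (u + u') %% (2 * p).
    have := divn_eq (u + u') (2 * p); rewrite -/h -e /code /w; nia.
  have N_mod : N %% (2 * p) = (u + u') %% (2 * p).
    by rewrite e' modnMDl modn_mod.
  have N_div : N %/ (2 * p) = w + p * (t + t') + h.
    by rewrite e' divnMDl ?divn_small ?ltn_mod ?addn0; lia.
  have s_h : u + u' = s h by rewrite /s N_mod /h [RHS]addnC [2 * p * _]mulnC -divn_eq.
  have z_h : z h = (t + t') * p + w by rewrite /z N_div addnK addnC mulnC.
  rewrite /K s_h eqxx z_h -/w modnMDl eqxx /= mul1n.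
  by rewrite divnMDl // eqxx.
apply: leq_trans (_ : \sum_(0 <= u < 2 * p) \sum_(0 <= u' < 2 * p)
   (K 0 u u' * load T T' (z 0 %/ p) + K 1 u u' * load T T' (z 1 %/ p)) <= _).
  rewrite !big_nat; apply: leq_sum => u u_lt.
  by rewrite !big_nat; apply: leq_sum => u' u'_lt; apply: bound.
under eq_bigr do rewrite big_split -!big_distrl.
rewrite big_split -!big_distrl mulnDr !mulnA leq_add //= leq_mul //.
  exact: count_pairs.
exact: count_pairs.
Qed.

Definition codes (S : seq ('F_p * seq nat)) : seq nat :=
  flatten [seq [seq code c.1 u t | u <- index_iota 0 (2 * p), t <- c.2] | c <- S].

Lemma sum_codes (S : seq ('F_p * seq nat)) (f : nat -> nat) :
  \sum_(a <- codes S) f a =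
  \sum_(c <- S) \sum_(0 <= u < 2 * p) \sum_(t <- c.2) f (code c.1 u t).
Proof.
by rewrite /codes big_flatten big_map; apply: eq_bigr => c _; rewrite big_allpairs_dep.
Qed.

Lemma mem_codes (S : seq ('F_p * seq nat)) c u t :
  c \in S -> u < 2 * p -> t \in c.2 -> code c.1 u t \in codes S.
Proof.
move=> cS u_lt tT; apply/flattenP.
exists [seq code c.1 u t | u <- index_iota 0 (2 * p), t <- c.2].
  by apply/mapP; exists c.
by apply: allpairs_f; rewrite // mem_index_iota.
Qed.

Definition total_load (Ts : seq (seq nat)) (v : nat) : nat :=
  \sum_(T <- Ts) \sum_(T' <- Ts) load T T' v.

(** Exactly one of the two carries has multiplicity 2: the carry 1 if [N %% (2 * p) < p], the carry
    0 otherwise. The third term is that extra copy. *)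
Lemma count_all_codes (S : seq ('F_p * seq nat)) (N : nat) :
  {in unzip1 S &, forall c d, c + d != 0}%R ->
  \sum_(a <- codes S) \sum_(b <- codes S) (a + b == N) <=
  2 * (total_load (unzip2 S) (N %/ (2 * p) %/ p) +
       total_load (unzip2 S) ((N %/ (2 * p) - 1) %/ p) +
       total_load (unzip2 S) ((N %/ (2 * p) - (N %% (2 * p) < p)) %/ p)).
Proof.
move=> S_neq0; set M := total_load _.
set s := N %% _; set q := N %/ _.
apply: leq_trans (_ : 2 * (multiplicity s * M (q %/ p) +
    multiplicity (s + 2 * p) * M ((q - 1) %/ p)) <= _).
  rewrite sum_codes.
  (* Reorder the six sums so that the two parabolas come first, then [u] and [u'], then the third
     digits. *)
  under eq_bigr do under eq_bigr do under eq_bigr do rewrite sum_codes.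
  under eq_bigr do under eq_bigr do rewrite exchange_big /=.
  under eq_bigr do rewrite exchange_big /=.
  under eq_bigr do under eq_bigr do under eq_bigr do rewrite exchange_big /=.
  rewrite mulnDr !mulnA /M /total_load !big_map.
  rewrite !big_distrr -big_split /= !big_seq; apply: leq_sum => c cS.
  rewrite !big_map !big_distrr -big_split /= !big_seq; apply: leq_sum => d dS.
  rewrite -!mulnA -mulnDr; apply: count_codes.
  by apply: S_neq0; apply: map_f.
rewrite leq_mul2l /= /multiplicity.
have s_lt : s < 2 * p by rewrite ltn_mod; lia.
case: (ltnP s p) => s_p /=.
  have -> : p <= s + 2 * p < 3 * p by lia.
  lia.
have -> : s < 3 * p by lia.
have -> : (p <= s + 2 * p < 3 * p) = false by lia.
by rewrite subn0; lia.
Qed.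

End Parabolas.

(** A finite table on which [gap_max] can be evaluated; its length exceeds every [t + t' + 1]. *)
Definition profile (Ts : seq (seq nat)) : seq nat :=
  [seq sumn [seq load T T' v | T <- Ts, T' <- Ts]
     | v <- iota 0 (sumn (flatten Ts)).*2.+2].

Lemma load_eq0 (T T' : seq nat) (v : nat) :
  sumn T + sumn T' + 1 < v -> load T T' v = 0.
Proof.
have le_sumn (s : seq nat) a : a \in s -> a <= sumn s.
  by elim: s => //= e s IHs; rewrite inE => /predU1P[->|/IHs]; lia.
move=> v_gt; rewrite /load.
rewrite (count_memPn _) ?max0n ?(count_memPn _) //;
  apply/allpairsP => -[[t t'] /= [/le_sumn ? /le_sumn ?]]; lia.
Qed.

Lemma nth_profile (Ts : seq (seq nat)) (v : nat) :
  nth 0 (profile Ts) v = total_load Ts v.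
Proof.
rewrite /profile; set L := _.*2.+2.
have [v_lt|v_ge] := ltnP v L.
  rewrite (nth_map 0) ?size_iota // nth_iota // add0n sumnE big_allpairs_dep.
  by [].
rewrite nth_default ?size_map ?size_iota // /total_load.
have le_sumn T : T \in Ts -> sumn T <= sumn (flatten Ts).
  by elim: (Ts) => //= T1 Ts1 IHs; rewrite inE sumn_cat => /predU1P[->|/IHs]; lia.
rewrite big_seq big1 // => T /le_sumn T_le; rewrite big_seq big1 // => T' /le_sumn T'_le.
by apply: load_eq0; rewrite /L in v_ge; lia.
Qed.

(** * From digit sets to the bound for Z/mZ *)

Section Scheme.
Variables (p : nat) (p_pr : prime p).
Let p_gt0 : 0 < p := prime_gt0 p_pr.

(** The range of [s] guarantees that [s - (x + x')] is 0, [p] or [2 p], which the second periods of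
    [u] and [u'] can supply. The carry of the second digits is 0 or 1, so the third digits must sum
    to [z %/ p] or to its predecessor. *)
Lemma sum_codes_hit (S : seq ('F_p * seq nat)) (c d : 'F_p) (T T' : seq nat)
    (s z : nat) :
  (c, T) \in S -> (d, T') \in S -> p <= s < 3 * p -> p <= z ->
  (exists x, c * x ^+ 2 + d * (s%:R - x) ^+ 2 = z%:R)%R ->
  z %/ p \in [seq t + t' | t <- T, t' <- T'] ->
  (z %/ p).-1 \in [seq t + t' | t <- T, t' <- T'] ->
  exists a b, [/\ a \in codes S, b \in codes S & a + b = s + 2 * p * z].
Proof.
move=> cS dS /andP[s_ge s_lt] z_ge [x xz] v_in v'_in.
pose x' : 'F_p := (s%:R - x)%R.
have lt_p (y : 'F_p) : y < p by move: (ltn_ord y); rewrite [X in _ < X](Fp_cast p_pr).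
have x_lt := lt_p x; have x'_lt := lt_p x'.
have x_mod : s = (x + x') %[mod p].
  apply/eqP; rewrite eqn_mod_Fp // natrD !natr_val_Fp //.
  by rewrite /x' addrC subrK.
rewrite -/x' in xz; clearbody x'.
have x_le : x + x' <= s.
  rewrite leqNgt; apply/negP => lt; move/eqP: x_mod.
  rewrite eq_sym eqn_mod_dvd ?(ltnW lt) //.
  by move/dvdn_leq; lia.
have /dvdnP[i s_eq] : p %| s - (x + x') by rewrite -eqn_mod_dvd //; apply/eqP.
have i_le : i <= 2 by nia.
pose w := parab c x + parab d x'.
have w_mod : z = w %[mod p].
  by apply/eqP; rewrite eqn_mod_Fp // /w natrD !natr_val_Fp -xz.
have w_lt : w < 2 * p.
  by rewrite /w; have := parab_lt p_pr c x; have := parab_lt p_pr d x'; lia.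
have j_le : w %/ p <= 1 by rewrite -ltnS ltn_divLR.
have v_gt0 : 0 < z %/ p by rewrite divn_gt0.
have [t [t' [tT t'T tt']]] : exists t t',
    [/\ t \in T, t' \in T' & t + t' + w %/ p = z %/ p].
  case: (w %/ p) j_le => [|[|//]] _.
    by case/allpairsP: v_in => -[t t'] /= [tT t'T ->]; exists t, t'; rewrite addn0.
  case/allpairsP: v'_in => -[t t'] /= [tT t'T e]; exists t, t'; split=> //.
  by rewrite -e addn1 prednK.
(* The missing [i * p] is split as one [p] for each summand, the first one being served first. *)
exists (code c (x + p * (0 < i)) t), (code d (x' + p * (1 < i)) t'); split.
- by apply: (mem_codes cS) => //=; move: (0 < i) x_lt => i0; clear; case: i0 => /=; lia.
- by apply: (mem_codes dS) => //=; move: (1 < i) x'_lt => i1; clear; case: i1 => /=; lia.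
rewrite /code !parab_periodic //.
have z_eq : z = w + p * (t + t').
  rewrite {1}(divn_eq z p) -tt' w_mod mulnDl -addnA -divn_eq addnC.
  by rewrite [p * _]mulnC.
have -> : s = x + x' + p * ((0 < i) + (1 < i)).
  have -> : (0 < i) + (1 < i) = i by case: i i_le {s_eq} => [|[|[|]]].
  by rewrite mulnC -s_eq subnKC.
by rewrite z_eq /w; ring.
Qed.

Lemma ruzsa_bound_scheme (m H w v : nat) (TP TQ TR : seq nat) :
    7 < p -> 0 < H -> gap_max H (profile [:: TP; TQ; TR]) <= 32 ->
    {subset iota v w.+1 <= [seq t + t' | t <- TP, t' <- TQ]} ->
    {subset iota v w.+1 <= [seq t + t' | t <- TR, t' <- TR]} ->
    H * p < m %/ (2 * p) -> m <= 2 * p * (p * w) ->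
  ruzsa_bound m 192.
Proof.
move=> p_gt7 H_gt0 gap_le subPQ subR m_ge m_le.
have p2_gt0 : 0 < 2 * p by rewrite muln_gt0.
have m_gt0 : 0 < m by case: m m_ge {m_le} => //; rewrite div0n.
have [] := @exists_parabolas 'F_p _ _.
- by rewrite -[0%R]/(0%:R)%R -eqn_mod_Fp // !modn_small //; lia.
- by rewrite card_Fp.
move=> a [b [c [abc_neq0 abc_cover]]].
pose S := [:: (a, TP); (b, TQ); (c, TR)].
apply/andP; split=> //; apply/existsP; exists (residues m (codes S)).
apply/forallP => n; apply/andP; split.
  apply: sigma_residues_gt0 => //.
  (* A window of length at least [m] starting at [N0] contains a representative [N] of [n];
     [N0 * (m - 1)] stands for [- N0] mod [m]. The window places [z %/ p] between [v + 1] and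
     [v + w], so that its predecessor is covered too. *)
  pose N0 := p + 2 * p * (p * v.+1).
  pose N := N0 + (n + N0 * (m - 1)) %% m.
  have N_mod : N = n %[mod m].
    rewrite /N modnDmr (_ : _ + _ = N0 * m + n) ?modnMDl //.
    by clear -m_gt0; case: m m_gt0 n => // m' _ n; rewrite subn1 /=; nia.
  have N_ge : N0 <= N by apply: leq_addr.
  have N_lt : N < N0 + 2 * p * (p * w).
    by rewrite ltn_add2l (leq_trans _ m_le) // ltn_mod.
  pose z := (N - p) %/ (2 * p); pose s := p + (N - p) %% (2 * p).
  have N_eq : N = s + 2 * p * z.
    have p_le : p <= N by apply: leq_trans N_ge; apply: leq_addr.
    by have := divn_eq (N - p) (2 * p); rewrite -/z /s; clear -p_le; lia.
  have s_lt : p <= s < 3 * p.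
    by rewrite /s leq_addr; have := ltn_pmod (N - p) p2_gt0; lia.
  have z_ge : p * v.+1 <= z by rewrite leq_divRL //; lia.
  have z_lt : z < p * v.+1 + p * w by rewrite ltn_divLR //; lia.
  have v_le : v < z %/ p by rewrite leq_divRL // mulnC.
  have v_lt : z %/ p < v.+1 + w by rewrite ltn_divLR //; lia.
  have [in1 in2] : z %/ p \in iota v w.+1 /\ (z %/ p).-1 \in iota v w.+1.
    by rewrite !mem_iota; move: (z %/ p) v_le v_lt => y; clear; lia.
  have z_gep : p <= z by apply: leq_trans z_ge; rewrite leq_pmulr.
  suff [k [l [kS lS kl]]] : exists k l, 
      [/\ k \in codes S, l \in codes S & k + l = s + 2 * p * z].
    by exists k, l; rewrite kl -N_eq.
  have [ab|cc] := abc_cover s%:R%R z%:R%R.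
    by apply: (@sum_codes_hit S a b TP TQ) => //; rewrite ?inE ?eqxx ?orbT ?subPQ.
  by apply: (@sum_codes_hit S c c TR TR) => //; rewrite ?inE ?eqxx ?orbT ?subR.
have [K le_K] := sigma_residues_le m_gt0 (codes S) n.
apply: leq_trans le_K _.
pose M := total_load [:: TP; TQ; TR].
pose q k := (n + k * m) %/ (2 * p).
(* The extra 1 in the gap pays for the possible subtraction of 1 in [gap_sum], leaving gaps of
   [H * p], hence of [H] after division by [p]. *)
have q_gap k : q k + (H * p).+1 <= q k.+1.
  by rewrite /q [k.+1 * m]mulSn addnCA [m + _]addnC (divnD _ m) // -addnA leq_add2l ltn_addr.
have gap_sum (e : nat -> bool) : \sum_(0 <= k < K) M ((q k - e k) %/ p) <= 32.
  under eq_bigr do rewrite /M -nth_profile.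
  apply: leq_trans gap_le; apply: gap_sum_le => // k.
  rewrite addnC -divnMDl //; apply: leq_div2r.
  by have := q_gap k; case: (e k); case: (e k.+1) => /=; lia.
pose e k := (n + k * m) %% (2 * p) < p.
apply: leq_trans (_ : \sum_(0 <= k < K) 2 * (M ((q k - false) %/ p) +
    M ((q k - true) %/ p) + M ((q k - e k) %/ p)) <= _).
  by apply: leq_sum => k _; rewrite subn0; apply: (count_all_codes p_pr).
rewrite -big_distrr !big_split /= -[192]/(2 * (32 + 32 + 32)) leq_mul2l /=.
by rewrite !leq_add ?(gap_sum (fun _ => false)) ?(gap_sum (fun _ => true)) ?(gap_sum e).
Qed.

End Scheme.

(* The digit sets were found by computer search. *)
Lemma ruzsa_bound_large (m p : nat) : prime p -> 7 < p ->
  8 * p ^ 2 + 2 * p <= m <= 32 * p ^ 2 -> ruzsa_bound m 192.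
Proof.
move=> p_pr p_gt /andP[m_ge m_le].
(* In each range of [m / p ^ 2], [w] is half the upper end, and [H] is an integer with
   [2 * H * p ^ 2 + 2 * p <= m]. *)
have [le12|gt12] := leqP m (12 * p ^ 2).
  apply: (@ruzsa_bound_scheme p p_pr m 4 6 2
    [:: 0; 1; 2; 3] [:: 2; 6] [:: 1; 2; 3; 4] p_gt isT).
  - by vm_compute.
  - by apply/allP; vm_compute.
  - by apply/allP; vm_compute.
  - by rewrite leq_divRL; nia.
  - by nia.
have [le16|gt16] := leqP m (16 * p ^ 2).
  apply: (@ruzsa_bound_scheme p p_pr m 5 8 0
    [:: 0; 1; 2] [:: 0; 3; 6] [:: 0; 1; 3; 4] p_gt isT).
  - by vm_compute.
  - by apply/allP; vm_compute.
  - by apply/allP; vm_compute.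
  - by rewrite leq_divRL; nia.
  - by nia.
have [le24|gt24] := leqP m (24 * p ^ 2).
  apply: (@ruzsa_bound_scheme p p_pr m 7 12 6
    [:: 4; 5; 6; 7] [:: 2; 6; 10; 12] [:: 3; 4; 6; 8; 9] p_gt isT).
  - by vm_compute.
  - by apply/allP; vm_compute.
  - by apply/allP; vm_compute.
  - by rewrite leq_divRL; nia.
  - by nia.
apply: (@ruzsa_bound_scheme p p_pr m 11 16 7
  [:: 6; 7; 8; 9; 10] [:: 1; 5; 10; 14] [:: 2; 4; 5; 8; 9; 11; 12] p_gt isT).
- by vm_compute.
- by apply/allP; vm_compute.
- by apply/allP; vm_compute.
- by rewrite leq_divRL; nia.
- by nia.
Qed.

Theorem theorem1 (m : nat) (hm : 0 < m) : ruzsa_number m <= 192.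
Proof.
rewrite /ruzsa_number; case: ex_minnP => r _; apply.
have [m_le|m_gt] := leqP m 4096.
  have /andP[_ /existsP[A /forallP sigmaA]] := ruzsa_bound_small hm m_le.
  apply/andP; split=> //; apply/existsP; exists A; apply/forallP => n.
  by have /andP[-> /leq_trans->] := sigmaA n.
(* With [32 n ^ 2 <= m < 32 (n + 1) ^ 2], a prime [p >= n + 1] gives the upper bound on [m], and
   [p <= 2 n - 1] gives the lower one with room for the term [2 p]. *)
have [n /andP[n_le n_lt]] := isqrt_exists (m %/ 32).
have m_ge : 32 * n ^ 2 <= m by rewrite mulnC -leq_divRL.
have m_lt : m < 32 * n.+1 ^ 2 by rewrite mulnC -ltn_divLR.
have n_gt : 10 < n by rewrite ltnNge; apply/negP => n_le10; nia.
have [|p p_pr /andP[p_gt p_lt]] := @bertrand n; first by lia.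
apply: (ruzsa_bound_large p_pr); first by lia.
by apply/andP; split; nia.
Qed.
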